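(* Let $r\ge 3$ and $r/2<s\le r-1$, and let $H$ be an $s$-connected $r$-uniform hypergraph on a finite vertex set $V$ with $|V|=n\ge r$. Let $\lambda_1^{(s)}$ be the first non-trivial (second smallest) eigenvalue of the $s$-th Laplacian of $H$. Let $0<\alpha<1$, let $f_0$ be any probability distribution on $V^{\underline{s}}$, and let $f_k$ be the distribution of the $k$-th stop of the $\alpha$-lazy random $s$-walk on $H$ whose initial stop has distribution $f_0$. Then $f_k$ converges to the stationary distribution $\pi$ as $k\to\infty$. In particular, for every integer $k\ge0$, $$\|(f_k-\pi)T^{-1/2}\|\le(\sigma_\alpha^{(s)})^k\,\|(f_0-\pi)T^{-1/2}\|,$$ where $\sigma_\alpha^{(s)}\le\sqrt{1-2\alpha(1-\alpha)\lambda_1^{(s)}}$.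
   Context: $V^{\underline{s}}$ is the set of ordered $s$-tuples of distinct elements of $V$; for $x\in V^{\underline{s}}$, $[x]$ is the $s$-set of its coordinates. An $r$-uniform hypergraph $H$ has edge set $E(H)\subseteq\binom{V}{r}$. For $S\subseteq V$ with $|S|<r$, $d_S$ is the number of edges containing $S$, and $\Gamma(S)=\{U: S\cap U=\emptyset,\ S\cup U\in E(H)\}$. An $s$-walk of length $k\ge 0$ is a sequence of vertices $v_1,\dots,v_{(r-s)(k-1)+r}$ such that $F_i=\{v_{(r-s)(i-1)+1},\dots,v_{(r-s)(i-1)+r}\}$ is an edge of $H$ (with $r$ distinct vertices) for $1\le i\le k$. Its $i$-th stop ($0\le i\le k$) is $x_i=(v_{(r-s)i+1},\dots,v_{(r-s)i+s})\in V^{\underline{s}}$. $H$ is $s$-connected if for every $x,y\in V^{\underline{s}}$ there is an $s$-walk with initial stop $x$ and terminal stop $y$. A random $s$-walk: at each step, if $S$ is the set of the last $s$ vertices of the current sequence (i.e. the current stop), choose an $(r-s)$-set from $\Gamma(S)$ uniformly at random and append its elements in a uniformly random order. The $\alpha$-lazy random $s$-walk stays at the current stop with probability $\alpha$ and otherwise makes a step of the random $s$-walk. For $r/2<s\le r-1$, $D^{(s)}$ is the directed graph on $V^{\underline{s}}$ in which $(x,y)$ is an edge iff $x_{r-s+j}=y_j$ for $1\le j\le 2s-r$ and $[x]\cup[y]\in E(H)$. Each $x$ has out-degree and in-degree both equal to $d_x=d_{[x]}(r-s)!$, so $D^{(s)}$ is Eulerian. The lazy walk on stops is the $\alpha$-lazy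 random walk on $D^{(s)}$: it goes from $x$ to $x$ with probability $\alpha$ and from $x$ to each out-neighbour with probability $(1-\alpha)/d_x$. Let $A$ be the adjacency matrix of $D^{(s)}$ ($A(x,y)=1$ iff $(x,y)$ is an edge), $T=\mathrm{diag}(d_x)$, $\vec{\mathcal L}=I-T^{-1/2}AT^{-1/2}$. The $s$-th Laplacian is $\mathcal L^{(s)}=(\vec{\mathcal L}+\vec{\mathcal L}^{\top})/2$, with eigenvalues listed in non-decreasing order with multiplicity as $\lambda_0^{(s)}\le\lambda_1^{(s)}\le\cdots$. Put $L_\alpha=\alpha I+(1-\alpha)T^{-1/2}AT^{-1/2}$ and $$\sigma_\alpha^{(s)}=\max\{\|L_\alpha f\|/\|f\| : f\ne0,\ f\perp T^{1/2}\mathbf 1\},$$ with $\mathbf 1$ the all-ones vector. The stationary distribution is $\pi(x)=d_x/\sum_y d_y$. Distributions are row vectors; $\|\cdot\|$ is the Euclidean norm; convergence is entrywise. *)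

(* Defs.v *)
From HB Require Import structures.
From mathcomp Require Import all_boot all_order all_algebra.
From mathcomp Require Import boolp classical_sets reals.
From mathcomp Require Import topology normedtype sequences.

Set Implicit Arguments.
Unset Strict Implicit.
Unset Printing Implicit Defensive.

Import Order.TTheory GRing.Theory Num.Theory.
Import numFieldNormedType.Exports.

Local Open Scope ring_scope.

Definition stop (V : finType) (s : nat) : predArgType :=
  {t : s.-tuple V | uniq t}.

Definition seq_of_stop (V : finType) (s : nat) (x : stop V s) : seq V :=
  tval (sval x).
Coercion seq_of_stop : stop >-> seq.

Definition stop_set (V : finType) (s : nat) (x : stop V s) : {set V} :=
  [set v in (x : seq V)].

Section Hypergraph.
Variables (V : finType) (E : {set {set V}}).

Definition uniform (r : nat) : Prop := forall e, e \in E -> #|e| = r.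

Definition deg (S : {set V}) : nat := #|[set e in E | S \subset e]|.

Definition link (S : {set V}) : {set {set V}} :=
  [set U : {set V} | [disjoint S & U] && (S :|: U \in E)].

(* [walk_edge v i] is $F_{i+1}$ and [walk_stop v i] is $x_i$; the length
   $(r-s)(k-1)+r$ is written $(r-s)k+s$ to avoid truncation at $k = 0$. *)
Definition walk_edge (r s : nat) (v : seq V) (i : nat) : seq V :=
  take r (drop ((r - s) * i) v).

Definition walk_stop (r s : nat) (v : seq V) (i : nat) : seq V :=
  take s (drop ((r - s) * i) v).

Definition is_walk (r s k : nat) (v : seq V) : Prop :=
  size v = ((r - s) * k + s)%N /\
  forall i, (i < k)%N ->
    uniq (walk_edge r s v i) /\ [set u in walk_edge r s v i] \in E.

Definition connected_by_walks (r s : nat) : Prop :=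
  forall x y : stop V s, exists k (v : seq V),
    [/\ is_walk r s k v, walk_stop r s v 0 = x & walk_stop r s v k = y].

Variables (R : realType) (r s : nat).

Definition orderings (U : {set V}) : {set (r - s).-tuple V} :=
  [set w : (r - s).-tuple V | uniq w && ([set v in w] == U)].

(* After appending [w] to a sequence ending in the stop [x], the last [s]
   vertices are [drop (r - s) x ++ w], because $r - s < s$. *)
Definition step (x y : stop V s) : R :=
  \sum_(U in link (stop_set x)) #|link (stop_set x)|%:R^-1 *
    \sum_(w in orderings U) #|orderings U|%:R^-1 *
      ((y : seq V) == drop (r - s) x ++ w)%:R.

Definition lazy_step (alpha : R) (x y : stop V s) : R :=
  alpha * (x == y)%:R + (1 - alpha) * step x y.

Definition trajectory_prob (alpha : R) (f0 : stop V s -> R) (k : nat)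
    (w : {ffun 'I_k.+1 -> stop V s}) : R :=
  f0 (w ord0) *
  \prod_(i < k) lazy_step alpha (w (widen_ord (leqnSn k) i)) (w (lift ord0 i)).

Definition stop_distr (alpha : R) (f0 : stop V s -> R) (k : nat)
    (x : stop V s) : R :=
  \sum_(w : {ffun 'I_k.+1 -> stop V s} | w ord_max == x)
    trajectory_prob alpha f0 w.

Definition stop_deg (x : stop V s) : nat :=
  (deg (stop_set x) * (r - s)`!)%N.

Definition stationary (x : stop V s) : R :=
  (stop_deg x)%:R / \sum_(y : stop V s) (stop_deg y)%:R.

Definition stop_arc (x y : stop V s) : bool :=
  (drop (r - s) x == take (2 * s - r) y) && (stop_set x :|: stop_set y \in E).

(* Matrices and vectors on the stops are indexed through [enum_val]. *)
Local Notation N := #|{: stop V s}|.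

Definition row_of (f : stop V s -> R) : 'rV[R]_N := \row_i f (enum_val i).

Definition adjacency : 'M[R]_N :=
  \matrix_(i, j) (stop_arc (enum_val i) (enum_val j))%:R.

Definition sqrtT : 'M[R]_N :=
  diag_mx (row_of (fun x => Num.sqrt (stop_deg x)%:R)).

Definition invsqrtT : 'M[R]_N :=
  diag_mx (row_of (fun x => (Num.sqrt (stop_deg x)%:R)^-1)).

Definition dir_laplacian : 'M[R]_N :=
  1%:M - invsqrtT *m adjacency *m invsqrtT.

Definition laplacian : 'M[R]_N :=
  2^-1 *: (dir_laplacian + dir_laplacian^T).

Definition lazy_mx (alpha : R) : 'M[R]_N :=
  alpha%:M + (1 - alpha) *: (invsqrtT *m adjacency *m invsqrtT).

End Hypergraph.

Definition is_distr (R : realType) (X : finType) (f : X -> R) : Prop :=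
  (forall x, 0 <= f x) /\ \sum_x f x = 1.

(* The library's norm on matrices is the maximum norm. *)
Definition enorm (R : realType) (m n : nat) (A : 'M[R]_(m, n)) : R :=
  Num.sqrt (\sum_i \sum_j A i j ^+ 2).

(* The eigenvalues with algebraic multiplicity, in non-decreasing order; the
   default [::] is taken only when the characteristic polynomial does not split
   over [R], which does not occur for a symmetric matrix. *)
Definition eigenvalues (R : realType) (n : nat) (A : 'M[R]_n) : seq R :=
  xget [::] [set l : seq R |
    sorted <=%R l /\ char_poly A = \prod_(a <- l) ('X - a%:P)]%classic.

Definition lambda1 (V : finType) (E : {set {set V}}) (R : realType)
    (r s : nat) : R :=
  nth 0 (eigenvalues (laplacian E R r s)) 1.

(* The supremum is a maximum: the quotient is continuous and invariant under
   scaling, so its values are those on a compact sphere. *)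
Definition sigma (V : finType) (E : {set {set V}}) (R : realType)
    (r s : nat) (alpha : R) : R :=
  sup [set q | exists f : 'cV[R]_#|{: stop V s}|,
    [/\ f != 0, f^T *m (sqrtT E R r s *m const_mx 1) = 0 :> 'M_1 &
        q = enorm (lazy_mx E r s alpha *m f) / enorm f]]%classic.

(* Main.v *)
(* Let M = T^{-1/2} A T^{-1/2} and phi = T^{1/2} 1.  Since D^(s) is Eulerian, M and
   M^T fix phi and |M f| <= |f|, so expanding the square gives
     |L_alpha f|^2 <= (alpha^2 + (1 - alpha)^2) |f|^2 + 2 alpha (1 - alpha) <f, M f>,
   where <f, M f> = |f|^2 - <f, L^(s) f> <= (1 - lambda_1) |f|^2 when f is orthogonal
   to phi.  For this last bound no min-max principle is needed: if lambda_1 > 0 then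
   the eigenvalue 0 is simple, hence phi spans its eigenspace, and if lambda_1 <= 0
   positive semidefiniteness suffices.  The deviations (f_k - pi) T^{-1/2} stay
   orthogonal to phi and are multiplied by L_alpha at each step.  Finally
     <T^{1/2} g, L^(s) T^{1/2} g> = 1/2 sum over arcs (x, y) of (g x - g y)^2
   and s-connectedness give lambda_1 > 0, hence sigma_alpha < 1.  Reversing tuples
   reverses the arcs of D^(s), so in-degrees equal out-degrees. *)
Require Import Defs.
From mathcomp Require Import all_boot all_order all_algebra.
From mathcomp Require Import boolp classical_sets reals.
From mathcomp Require Import topology normedtype sequences.
From mathcomp Require Import spectral complex ring zify.

Set Implicit Arguments.
Unset Strict Implicit.
Unset Printing Implicit Defensive.

Import Order.TTheory GRing.Theory Num.Theory.
Import numFieldNormedType.Exports.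

Local Open Scope ring_scope.

(** * The spectral theorem for real symmetric matrices *)

(** An eigenvalue [a] exists over the algebraically closed field [R[i]], with eigenvector [v]. For
    [w] the conjugate transpose of [v], the scalar [v *m A *m w] is self-conjugate because [A] is
    real and symmetric, and it equals [a] times the positive number [v *m w]. So [a] is real, and
    the root of the characteristic polynomial descends to [R]. *)
Lemma symmetric_eigenvalue (R : rcfType) n (A : 'M[R]_n.+1) :
  A^T = A -> exists a, eigenvalue A a.
Proof.
move=> symA; pose iota := real_complex R.
have [a] := @eigenvalue_closed (R[i]) _ (map_mx iota A) isT.
move=> eva; have [v vA v0] := eigenvalueP eva.
pose w := (map_mx Num.conj v)^T.
have wP : v *m w = (\sum_j `|v 0 j| ^+ 2)%:M.
  apply/matrixP=> i j; rewrite !ord1 !mxE eqxx mulr1n.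
  by apply: eq_bigr => k _; rewrite !mxE normCK.
have sv0 : \sum_j `|v 0 j| ^+ 2 != 0.
  apply: contraNneq v0 => s0; apply/eqP/rowP=> j; rewrite mxE.
  have /psumr_eq0P : forall j, true -> 0 <= `|v 0 j| ^+ 2.
    by move=> k _; rewrite exprn_ge0.
  by move=> /(_ s0 j isT) /eqP; rewrite expf_eq0 normr_eq0 => /eqP.
have vw : v *m map_mx iota A *m w = (a * \sum_j `|v 0 j| ^+ 2)%:M.
  by rewrite vA -scalemxAl wP -scale_scalar_mx.
have cA : map_mx Num.conj (map_mx iota A) = map_mx iota A.
  by apply/matrixP=> i j; rewrite !mxE conj_Creal // complex_real.
have cv : map_mx Num.conj (map_mx Num.conj v) = v.
  by apply/matrixP=> i j; rewrite !mxE conjCK.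
have AT : (map_mx iota A)^T = map_mx iota A by rewrite map_trmx symA.
have cj : map_mx Num.conj (v *m map_mx iota A *m w)^T = v *m map_mx iota A *m w.
  by rewrite !trmx_mul AT trmxK !map_mxM cA -map_trmx cv mulmxA.
have ra : a \is Num.real.
  apply/CrealP; apply: (mulIf sv0).
  have /matrixP/(_ 0 0) := cj; rewrite vw !mxE eqxx mulr1n rmorphM /= => <-.
  congr (_ * _); apply/esym/CrealP/sum_real => k _.
  by rewrite realX // normr_real.
have /complex_realP[b ab] := ra.
exists b; rewrite eigenvalue_root_char.
by move: eva; rewrite eigenvalue_root_char ab -map_char_poly fmorph_root.
Qed.

Lemma mulmx_tr_gt0 (R : realFieldType) n (v : 'rV[R]_n) :
  v != 0 -> 0 < (v *m v^T) 0 0.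
Proof.
move=> v0; rewrite mxE lt0r sumr_ge0 ?andbT => [|j _]; last first.
  by rewrite mxE -expr2 sqr_ge0.
apply: contraNneq v0 => s0; apply/eqP/rowP=> j; rewrite [RHS]mxE.
have /psumr_eq0P : forall j, true -> 0 <= v 0 j * v^T j 0.
  by move=> k _; rewrite [v^T _ _]mxE -expr2 sqr_ge0.
by move=> /(_ s0 j isT) /eqP; rewrite [v^T _ _]mxE mulf_eq0 orbb => /eqP.
Qed.

(** The reflection along [w = v - e] exchanges the unit vectors [e] and [v]. Since [w] has squared
    length [2 * c] with [c = 1 - v 0 0], the usual factor 2 over the squared length is [c^-1]. The
    case [v = e] is separate, as there [w] vanishes. *)
Lemma householder (R : realFieldType) n (v : 'rV[R]_(1 + n)) :
  v *m v^T = 1%:M -> exists2 H : 'M[R]_(1 + n), H *m H^T = 1%:M & row 0 H = v.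
Proof.
move=> v1; pose e : 'rV[R]_(1 + n) := delta_mx 0 0; pose w := v - e.
have eT (u : 'rV_(1 + n)) : e *m u^T = (u 0 0)%:M.
  by apply/matrixP=> i j; rewrite !ord1 -rowE !mxE eqxx.
have ue (u : 'rV_(1 + n)) : u *m e^T = (u 0 0)%:M.
  by rewrite -[u *m _]trmxK trmx_mul trmxK eT tr_scalar_mx.
have [w0|w0] := eqVneq w 0.
  exists 1%:M; first by rewrite trmx1 mulmx1.
  by rewrite rowE mulmx1; apply/esym/eqP; rewrite -subr_eq0 -/e -/w w0.
pose c : R := 1 - v 0 0.
have ww : w *m w^T = (2 * c)%:M.
  rewrite /w linearB /= mulmxBl !mulmxBr v1 !eT !ue !mxE !eqxx -!raddfB /=.
  by congr _%:M; rewrite /c; ring.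
have c0 : c != 0.
  apply: contraTneq (mulmx_tr_gt0 w0) => c0.
  by rewrite ww c0 mulr0 mxE mul0rn ltxx.
have [S SE] : exists S, S = w^T *m w by exists (w^T *m w).
exists (1%:M - c^-1 *: S).
  have ST : S^T = S by rewrite SE trmx_mul trmxK.
  have SS : S *m S = (2 * c) *: S.
    by rewrite SE mulmxA -[w^T *m w *m w^T]mulmxA ww mul_mx_scalar -scalemxAl.
  have -> : (1%:M - c^-1 *: S)^T = 1%:M - c^-1 *: S.
    by rewrite linearB /= linearZ /= ST trmx1.
  rewrite mulmxBl !mulmxBr !mul1mx mulmx1.
  rewrite -scalemxAl -scalemxAr SS !scalerA.
  have -> : c^-1 / c * (2 * c) = c^-1 + c^-1 by field.
  by rewrite scalerDl opprB addrK subrK.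
(* The first row is [e - c^-1 * w 0 0 *: w], which is [e + w = v] because [w 0 0 = - c]. *)
rewrite rowE mulmxBr mulmx1 -scalemxAr SE mulmxA eT mul_scalar_mx scalerA.
have -> : w 0 0 = - c by rewrite /c !mxE !eqxx opprB.
by rewrite mulrN mulVf // scaleN1r opprK addrC subrK.
Qed.

(** Deflation: a unit eigenvector is completed to an orthogonal matrix [H]. The first row of
    [H *m A *m H^T] is then [a] times the first unit vector, and symmetry clears the first column as
    well, so the induction hypothesis applies to the lower right block. *)
Lemma real_spectral (R : rcfType) n (A : 'M[R]_n) : A^T = A ->
  exists (P : 'M[R]_n) (d : 'rV[R]_n),
    P *m P^T = 1%:M /\ A = P^T *m diag_mx d *m P.
Proof.
elim: n A => [|n IHn] A symA.
  by exists 1%:M, 0; split; apply/matrixP=> - [].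
have [a /eigenvalueP[u uA u0]] := symmetric_eigenvalue symA.
have c0 := mulmx_tr_gt0 u0; set c := (_ *m _) 0 0 in c0.
pose v := (Num.sqrt c)^-1 *: u.
have v1 : v *m v^T = 1%:M.
  rewrite /v linearZ /= -scalemxAl -scalemxAr scalerA [u *m _]mx11_scalar -/c.
  by rewrite scale_scalar_mx -invfM -expr2 sqr_sqrtr ?mulVf ?gt_eqF // ltW.
have vA : v *m A = a *: v by rewrite /v -scalemxAl uA !scalerA mulrC.
have [H HH H0] := @householder R n v v1.
have HTH : H^T *m H = 1%:M by apply: mulmx1C.
pose B : 'M_(1 + n) := H *m A *m H^T.
have symB : B^T = B by rewrite /B !trmx_mul trmxK symA mulmxA.
have rB : row 0 B = a *: delta_mx 0 0.
  rewrite /B !row_mul H0 vA -scalemxAl -H0 -row_mul HH.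
  by congr (_ *: _); rewrite rowE mulmx1.
have B0 i j : val i = 0 -> B i j = a *+ (val j == 0).
  move=> i0; have -> : i = 0 by apply: val_inj.
  by have /rowP/(_ j) := rB; rewrite !mxE /= => ->; rewrite mulr_natr.
have ulB : ulsubmx B = a%:M.
  by apply/matrixP=> i j; rewrite !ord1 [LHS]mxE [LHS]mxE B0 // mxE.
have urB : ursubmx B = 0.
  by apply/matrixP=> i j; rewrite !ord1 [LHS]mxE [LHS]mxE B0 // mxE.
have dlB : dlsubmx B = 0.
  by rewrite -[LHS]trmxK trmx_dlsub symB urB trmx0.
have [|Q [d [QQ BQ]]] := IHn (drsubmx B); first by rewrite trmx_drsub symB.
pose Q' : 'M_(1 + n) := block_mx 1%:M 0 0 Q.
have QT : Q'^T = block_mx 1%:M 0 0 Q^T by rewrite /Q' tr_block_mx !trmx0 trmx1.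
have QQ' : Q' *m Q'^T = 1%:M.
  rewrite QT mulmx_block !mulmx0 !mul0mx !addr0 add0r mulmx1 QQ.
  by rewrite -scalar_mx_block.
have BE : B = Q'^T *m diag_mx (row_mx a%:M d) *m Q'.
  rewrite -[LHS]submxK ulB urB dlB BQ diag_mx_row QT.
  rewrite !mulmx_block !(mulmx0, mul0mx, addr0, add0r) mul1mx mulmx1.
  by congr block_mx; apply/matrixP=> i j; rewrite !ord1 !mxE.
exists (Q' *m H), (row_mx a%:M d); split.
  by rewrite trmx_mul mulmxA -(mulmxA Q') HH mulmx1 QQ'.
have -> : A = H^T *m B *m H by rewrite /B !mulmxA HTH mul1mx -mulmxA HTH mulmx1.
by rewrite BE trmx_mul !mulmxA.
Qed.

(** * The Euclidean inner product of column vectors *)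

Definition dotc (R : pzSemiRingType) n (u v : 'cV[R]_n) : R := (u^T *m v) 0 0.

Lemma dotcE (R : pzSemiRingType) n (u v : 'cV[R]_n) :
  dotc u v = \sum_i u i 0 * v i 0.
Proof. by rewrite /dotc mxE; apply: eq_bigr => i _; rewrite mxE. Qed.

Lemma dotcC (R : comPzSemiRingType) n (u v : 'cV[R]_n) : dotc u v = dotc v u.
Proof. by rewrite !dotcE; apply: eq_bigr => i _; rewrite mulrC. Qed.

Lemma dotc_mulmxr (R : comPzSemiRingType) m n (u : 'cV[R]_m) (A : 'M_(m, n)) v :
  dotc u (A *m v) = dotc (A^T *m u) v.
Proof. by rewrite /dotc trmx_mul trmxK mulmxA. Qed.

Lemma dotcDl (R : pzSemiRingType) n (u v w : 'cV[R]_n) :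
  dotc (u + v) w = dotc u w + dotc v w.
Proof. by rewrite /dotc linearD /= mulmxDl mxE. Qed.

Lemma dotcDr (R : pzSemiRingType) n (u v w : 'cV[R]_n) :
  dotc u (v + w) = dotc u v + dotc u w.
Proof. by rewrite /dotc mulmxDr mxE. Qed.

Lemma dotcZl (R : pzRingType) n a (u v : 'cV[R]_n) :
  dotc (a *: u) v = a * dotc u v.
Proof. by rewrite /dotc linearZ /= -scalemxAl mxE. Qed.

Lemma dotcZr (R : comPzRingType) n a (u v : 'cV[R]_n) :
  dotc u (a *: v) = a * dotc u v.
Proof. by rewrite dotcC dotcZl dotcC. Qed.

Lemma dotc_ge0 (R : realDomainType) n (u : 'cV[R]_n) : 0 <= dotc u u.
Proof. by rewrite dotcE; apply: sumr_ge0 => i _; rewrite -expr2 sqr_ge0. Qed.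

Lemma dotc_eq0 (R : realDomainType) n (u : 'cV[R]_n) :
  (dotc u u == 0) = (u == 0).
Proof.
apply/idP/eqP => [|->]; last by rewrite /dotc mulmx0 mxE.
rewrite dotcE psumr_eq0 => [/allP u0|i _]; last by rewrite -expr2 sqr_ge0.
apply/colP=> i; rewrite [RHS]mxE.
by have := u0 i (mem_index_enum _); rewrite /= mulf_eq0 orbb => /eqP.
Qed.

(** * The sorted eigenvalue list of a diagonalised symmetric matrix *)

Section SymmetricEigenvalues.
Variables (R : realType) (n : nat) (A P : 'M[R]_n) (d : 'rV[R]_n).
Hypotheses (PPT : P *m P^T = 1%:M) (AE : A = P^T *m diag_mx d *m P).

Let PTP : P^T *m P = 1%:M. Proof. exact: mulmx1C. Qed.

Lemma char_poly_spectral : char_poly A = \prod_(i < n) ('X - (d 0 i)%:P).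
Proof.
have -> : char_poly A = char_poly (diag_mx d).
  rewrite /char_poly /char_poly_mx AE.
  have -> : 'X%:M - map_mx polyC (P^T *m diag_mx d *m P) =
     map_mx polyC P^T *m ('X%:M - map_mx polyC (diag_mx d)) *m map_mx polyC P.
    rewrite mulmxBr mulmxBl -!map_mxM mul_mx_scalar -scalemxAl -map_mxM PTP.
    by rewrite map_mx1 scalemx1.
  by rewrite !det_mulmx mulrAC -det_mulmx -map_mxM PTP map_mx1 det1 mul1r.
rewrite char_poly_trig ?diag_mx_is_trig //.
by apply: eq_bigr => i _; rewrite mxE eqxx.
Qed.

(** The sorted diagonal witnesses the defining property of [eigenvalues], so the default [[::]] is
    not taken; unique factorisation into linear factors identifies any other choice up to
    permutation. *)
Lemma eigenvalues_spectral :
  sorted <=%R (eigenvalues A) /\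
  perm_eq (eigenvalues A) [seq d 0 i | i <- enum 'I_n].
Proof.
pose Q := [set l : seq R |
    sorted <=%R l /\ char_poly A = \prod_(a <- l) ('X - a%:P)]%classic.
have [sl cl] : Q (eigenvalues A).
  apply: xgetPex; exists (sort <=%R [seq d 0 i | i <- enum 'I_n]); split.
    exact: sort_le_sorted.
  rewrite char_poly_spectral (perm_big [seq d 0 i | i <- enum 'I_n]) /=.
    by rewrite big_map big_enum.
  by rewrite perm_sort.
split=> //; apply: prod_XsubC_eq; rewrite -cl char_poly_spectral big_map big_enum //=.
Qed.

Lemma dotc_spectral f : dotc f (A *m f) = \sum_i d 0 i * (P *m f) i 0 ^+ 2.
Proof.
rewrite AE -!mulmxA dotc_mulmxr trmxK dotcE; apply: eq_bigr => i _.
by rewrite mul_diag_mx [X in _ * X]mxE mulrCA expr2.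
Qed.

Lemma dotc_isometry f g : dotc (P *m f) (P *m g) = dotc f g.
Proof. by rewrite dotc_mulmxr mulmxA PTP mul1mx. Qed.

(** In a sorted list at most one entry lies strictly below the entry of index 1. The index [i0]
    already accounts for it, so a second index [i] below would contradict the count. *)
Lemma second_eigenvalue_le i0 i : d 0 i0 < nth 0 (eigenvalues A) 1 ->
  i != i0 -> nth 0 (eigenvalues A) 1 <= d 0 i.
Proof.
have [sl pl] := eigenvalues_spectral.
set l1 := nth _ _ _ => d0 ii0; rewrite leNgt; apply/negP=> di.
have : (count (< l1) (eigenvalues A) <= 1)%N.
  rewrite /l1; case: (eigenvalues A) sl => [|x [|y l]] //=; first by case: (_ < _).
  move=> /andP[xy yl]; rewrite ltxx add0n.
  rewrite -[1%N]addn0 leq_add //; first by case: (_ < _).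
  rewrite leqn0 -[_ == _]negbK -lt0n -has_count -all_predC.
  by apply: sub_all (order_path_min le_trans yl) => z /=; rewrite -leNgt.
rewrite (permP pl) count_map -sum1_count big_enum_cond /= sum1dep_card leqNgt.
by move/negP; apply; apply/card_gt1P; exists i, i0; rewrite !inE.
Qed.

(** The entries of index 0 and 1 both count; [1 < n] guarantees that index 1 is a genuine entry and
    not the default of [nth]. *)
Lemma second_eigenvalue_ge : (1 < n)%N -> exists i j,
  [/\ i != j, d 0 i <= nth 0 (eigenvalues A) 1 & d 0 j <= nth 0 (eigenvalues A) 1].
Proof.
move=> n1; have [sl pl] := eigenvalues_spectral.
set l1 := nth _ _ _.
have : (1 < count (<= l1) (eigenvalues A))%N.
  have : (1 < size (eigenvalues A))%N by rewrite (perm_size pl) size_map size_enum_ord.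
  rewrite /l1; case: (eigenvalues A) sl => [|x [|y l]] //=.
  by move=> /andP[-> _] _; rewrite lexx.
rewrite (permP pl) count_map -sum1_count big_enum_cond /= sum1dep_card.
by move=> /card_gt1P[i [j []]]; rewrite !inE => di dj ij; exists i, j.
Qed.

End SymmetricEigenvalues.

(** * Rayleigh quotients and the second eigenvalue *)

Section Rayleigh.
Variables (R : realType) (n : nat) (A : 'M[R]_n) (phi : 'cV[R]_n).
Hypothesis symA : A^T = A.

Lemma rayleigh_second_eigenvalue f :
  (forall g, 0 <= dotc g (A *m g)) -> phi != 0 -> A *m phi = 0 ->
  dotc f phi = 0 ->
  nth 0 (eigenvalues A) 1 * dotc f f <= dotc f (A *m f).
Proof.
move=> psdA phi0 Aphi fphi; set l1 := nth _ _ _.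
(* For [n <= 1] the default of [nth] makes [l1] equal to 0, so that case falls into the first
   branch. *)
have [l1_le0|l1_gt0] := leP l1 0.
  by rewrite (le_trans _ (psdA f)) // mulr_le0_ge0 // dotc_ge0.
have [P [d [PPT AE]]] := real_spectral symA.
have dP i : d 0 i * (P *m phi) i 0 = 0.
  have : P *m (A *m phi) = diag_mx d *m (P *m phi).
    by rewrite AE !mulmxA PPT mul1mx.
  by rewrite Aphi mulmx0 => /colP/(_ i); rewrite mul_diag_mx !mxE.
(* In eigencoordinates [phi] lives where [d] vanishes. Once one such index [i0] is found, every
   other [d 0 i] is at least [l1 > 0], so [phi] is supported at [i0] alone and [f], being orthogonal
   to it, has coordinate 0 there. *)
have [i0 Pi0] : exists i0, (P *m phi) i0 0 != 0.
  apply/existsP; apply: contraNT phi0; rewrite negb_exists => /forallP P0.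
  rewrite -dotc_eq0 -(dotc_isometry PPT) dotcE big1 // => i _.
  by have := P0 i; rewrite negbK => /eqP ->; rewrite mul0r.
have d0 : d 0 i0 = 0.
  by apply/eqP; move/eqP: (dP i0); rewrite mulf_eq0 (negPf Pi0) orbF.
have ge_l1 i : i != i0 -> l1 <= d 0 i.
  by apply: (second_eigenvalue_le PPT AE); rewrite d0.
have Pphi0 i : i != i0 -> (P *m phi) i 0 = 0.
  move=> /ge_l1 di; apply/eqP; move/eqP: (dP i); rewrite mulf_eq0.
  by rewrite gt_eqF // (lt_le_trans l1_gt0).
have Pf0 : (P *m f) i0 0 = 0.
  apply/eqP; move: fphi; rewrite -(dotc_isometry PPT) dotcE (bigD1 i0) //=.
  rewrite big1 => [|i /Pphi0 ->]; last by rewrite mulr0.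
  by rewrite addr0 => /eqP; rewrite mulf_eq0 (negPf Pi0) orbF.
rewrite (dotc_spectral AE) -(dotc_isometry PPT f f) dotcE mulr_sumr.
apply: ler_sum => i _; rewrite -expr2.
have [->|/ge_l1 di] := eqVneq i i0; first by rewrite Pf0 expr0n !mulr0.
by rewrite ler_wpM2r // sqr_ge0.
Qed.

(** Otherwise two orthonormal eigenvectors [u i] and [u j] have a nonpositive quadratic form and are
    both multiples of [phi]. Their inner product [ci * cj * dotc phi phi] is 0, and the vanishing of
    any factor makes a unit vector null. *)
Lemma second_eigenvalue_gt0 : (1 < n)%N ->
  (forall f, dotc f (A *m f) <= 0 -> exists c, f = c *: phi) ->
  0 < nth 0 (eigenvalues A) 1.
Proof.
move=> n1 kerA; rewrite ltNge; apply/negP => l1_le0.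
have [P [d [PPT AE]]] := real_spectral symA.
have [i [j [ij di dj]]] := second_eigenvalue_ge PPT AE n1.
pose u k : 'cV_n := P^T *m delta_mx k 0.
have Pu k : P *m u k = delta_mx k 0 by rewrite mulmxA PPT mul1mx.
have uu k l : dotc (u k) (u l) = (k == l)%:R.
  rewrite -(dotc_isometry PPT) !Pu dotcE (bigD1 k) //= big1 => [|m /negPf mk].
    by rewrite !mxE !eqxx mul1r andbT addr0.
  by rewrite !mxE mk mul0r.
have uker k : d 0 k <= nth 0 (eigenvalues A) 1 -> exists c, u k = c *: phi.
  move=> dk; apply: kerA; rewrite (dotc_spectral AE) Pu (bigD1 k) //= big1.
    by rewrite mxE !eqxx expr1n mulr1 addr0 (le_trans dk).
  by move=> m /negPf mk; rewrite mxE mk expr0n mulr0.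
have [ci ui] := uker i di; have [cj uj] := uker j dj.
have := uu i j; rewrite (negPf ij) ui uj dotcZl dotcZr => /eqP.
rewrite !mulf_eq0 => /or3P[] /eqP c0; [have := uu i i|have := uu j j|have := uu i i].
- by rewrite ui c0 scale0r /dotc mulmx0 mxE eqxx => /esym/eqP; rewrite oner_eq0.
- by rewrite uj c0 scale0r /dotc mulmx0 mxE eqxx => /esym/eqP; rewrite oner_eq0.
by rewrite ui dotcZl dotcZr c0 !mulr0 eqxx => /esym/eqP; rewrite oner_eq0.
Qed.

End Rayleigh.

(** * Eulerian weighted digraphs *)

Section Eulerian.
Variables (R : realType) (n : nat) (A : 'M[R]_n) (t : 'rV[R]_n).
Hypothesis A_ge0 : forall i j, 0 <= A i j.
Hypothesis t_gt0 : forall i, 0 < t 0 i.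
Hypothesis outA : forall i, \sum_j A i j = t 0 i.
Hypothesis inA : forall j, \sum_i A i j = t 0 j.

Definition diag_sqrt : 'M[R]_n := diag_mx (map_mx Num.sqrt t).
Definition diag_invsqrt : 'M[R]_n := diag_mx (map_mx (fun a => (Num.sqrt a)^-1) t).
Definition normalized : 'M[R]_n := diag_invsqrt *m A *m diag_invsqrt.
Definition top_vector : 'cV[R]_n := diag_sqrt *m const_mx 1.
Definition normalized_laplacian : 'M[R]_n :=
  2^-1 *: ((1%:M - normalized) + (1%:M - normalized)^T).

Let sqrt_neq0 i : Num.sqrt (t 0 i) != 0.
Proof. by rewrite gt_eqF // sqrtr_gt0. Qed.

Lemma diag_sqrtK : diag_sqrt *m diag_invsqrt = 1%:M.
Proof.
rewrite mulmx_diag; apply/matrixP=> i j; rewrite !mxE.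
by rewrite divff.
Qed.

Lemma diag_invsqrtK : diag_invsqrt *m diag_sqrt = 1%:M.
Proof. exact: mulmx1C diag_sqrtK. Qed.

Lemma normalized_sqrt f :
  normalized *m (diag_sqrt *m f) = diag_invsqrt *m (A *m f) :> 'cV_n.
Proof.
by rewrite !mulmxA -(mulmxA _ _ diag_sqrt) diag_invsqrtK mulmx1.
Qed.

Lemma normalized_top : normalized *m top_vector = top_vector.
Proof.
rewrite /top_vector normalized_sqrt; apply/colP=> i; rewrite !mul_diag_mx !mxE.
have -> : \sum_j A i j * (const_mx 1 : 'cV_n) j 0 = t 0 i.
  by rewrite -outA; apply: eq_bigr => j _; rewrite mxE mulr1.
by rewrite mulr1 -{2}(sqr_sqrtr (ltW (t_gt0 i))) expr2 mulKf.
Qed.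

Lemma dotc_normalized f g :
  dotc (diag_sqrt *m f) (normalized *m (diag_sqrt *m g)) =
  \sum_i \sum_j A i j * (f i 0 * g j 0).
Proof.
rewrite normalized_sqrt dotcE; apply: eq_bigr => i _.
rewrite !mul_diag_mx !mxE mulrACA mulfV // mul1r mulr_sumr.
by apply: eq_bigr => j _; rewrite mulrCA.
Qed.

Lemma dotc_diag_sqrt f :
  dotc (diag_sqrt *m f) (diag_sqrt *m f) = \sum_i t 0 i * f i 0 ^+ 2.
Proof.
rewrite dotcE; apply: eq_bigr => i _; rewrite mul_diag_mx !mxE.
by rewrite mulrACA -!expr2 sqr_sqrtr // ltW.
Qed.

(** Write [f] as [diag_sqrt *m g]. The column sums turn the squared norm of [f] into the sum of
    [A i j * g j 0 ^+ 2], and row [i] of the image contributes the square of the sum of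
    [A i j * g j 0] divided by [t 0 i]. The rows are then compared one at a time, using that row [i]
    has total weight [t 0 i]. *)
Lemma normalized_contraction f :
  dotc (normalized *m f) (normalized *m f) <= dotc f f.
Proof.
have -> : f = diag_sqrt *m (diag_invsqrt *m f) by rewrite mulmxA diag_sqrtK mul1mx.
set g := diag_invsqrt *m f.
rewrite dotc_diag_sqrt dotcE.
under [leRHS]eq_bigr => j _ do rewrite -inA mulr_suml.
rewrite exchange_big /=; apply: ler_sum => i _.
rewrite normalized_sqrt !mul_diag_mx !mxE -expr2 exprMn exprVn.
rewrite (sqr_sqrtr (ltW (t_gt0 i))).
rewrite mulrC ler_pdivrMr //.
pose a j := A i j; pose S1 := \sum_j a j * g j 0.
(* Cauchy-Schwarz through the variance: [sum a (t g - S1)^2 >= 0]. *)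
have : 0 <= \sum_j a j * (t 0 i * g j 0 - S1) ^+ 2.
  by apply: sumr_ge0 => j _; rewrite mulr_ge0 ?A_ge0 ?sqr_ge0.
have expand c : \sum_j a j * (t 0 i * g j 0 - c) ^+ 2 =
    t 0 i ^+ 2 * (\sum_j a j * g j 0 ^+ 2) - 2 * t 0 i * c * (\sum_j a j * g j 0)
    + c ^+ 2 * \sum_j a j.
  rewrite !mulr_sumr -sumrN -!big_split /=.
  by apply: eq_bigr => j _; ring.
have -> : \sum_j a j * (t 0 i * g j 0 - S1) ^+ 2 =
  t 0 i * ((\sum_j a j * g j 0 ^+ 2) * t 0 i - S1 ^+ 2).
  by rewrite expand outA -/S1; ring.
by rewrite pmulr_rge0 // subr_ge0.
Qed.

(** A matrix and its transpose have the same quadratic form, so symmetrising leaves the form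
    unchanged. *)
Lemma dotc_laplacian f :
  dotc f (normalized_laplacian *m f) = dotc f f - dotc f (normalized *m f).
Proof.
have e : dotc f ((1%:M - normalized) *m f) = dotc f f - dotc f (normalized *m f).
  by rewrite mulmxBl mul1mx /dotc mulmxBr !mxE.
rewrite -scalemxAl dotcZr mulmxDl dotcDr [X in _ + X]dotc_mulmxr trmxK.
by rewrite [X in _ + X]dotcC e; field.
Qed.

(** After expanding the square, the row sums evaluate the terms in [f i 0 ^+ 2] and the column sums
    those in [f j 0 ^+ 2]; the Eulerian condition makes the two totals equal. *)
Lemma dirichlet_form f :
  dotc (diag_sqrt *m f) (normalized_laplacian *m (diag_sqrt *m f)) =
  2^-1 * \sum_i \sum_j A i j * (f i 0 - f j 0) ^+ 2.
Proof.
rewrite dotc_laplacian dotc_normalized dotc_diag_sqrt.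
have -> : \sum_i \sum_j A i j * (f i 0 - f j 0) ^+ 2 =
  \sum_i \sum_j A i j * f i 0 ^+ 2 + \sum_i \sum_j A i j * f j 0 ^+ 2
  - 2 * \sum_i \sum_j A i j * (f i 0 * f j 0).
  rewrite mulr_sumr -sumrN -!big_split /=; apply: eq_bigr => i _.
  rewrite mulr_sumr -sumrN -!big_split /=; apply: eq_bigr => j _.
  by ring.
rewrite [X in _ + X - _]exchange_big /=.
under [X in _ = 2^-1 * (X + _ - _)]eq_bigr => i _ do rewrite -mulr_suml outA.
under [X in _ = 2^-1 * (_ + X - _)]eq_bigr => i _ do rewrite -mulr_suml inA.
by field.
Qed.

Lemma laplacian_ge0 f : 0 <= dotc f (normalized_laplacian *m f).
Proof.
have -> : f = diag_sqrt *m (diag_invsqrt *m f) by rewrite mulmxA diag_sqrtK mul1mx.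
rewrite dirichlet_form mulr_ge0 ?invr_ge0 //.
by do 2![apply: sumr_ge0 => ? _]; rewrite mulr_ge0 ?sqr_ge0.
Qed.

Lemma laplacian_sym : normalized_laplacian^T = normalized_laplacian.
Proof. by rewrite /normalized_laplacian linearZ /= linearD /= trmxK addrC. Qed.

End Eulerian.

(** * The Euclidean norm and the Cauchy-Schwarz inequality *)

Lemma enorm_col (R : realType) n (f : 'cV[R]_n) : enorm f = Num.sqrt (dotc f f).
Proof.
rewrite /enorm dotcE; congr Num.sqrt; apply: eq_bigr => i _.
by rewrite big_ord1 expr2.
Qed.

Lemma enorm_tr (R : realType) m n (A : 'M[R]_(m, n)) : enorm A^T = enorm A.
Proof.
rewrite /enorm exchange_big /=; congr Num.sqrt.
by do 2![apply: eq_bigr => ? _]; rewrite mxE.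
Qed.

Lemma enorm_ge0 (R : realType) m n (A : 'M[R]_(m, n)) : 0 <= enorm A.
Proof. exact: sqrtr_ge0. Qed.

Lemma enorm_entry (R : realType) m n (A : 'M[R]_(m, n)) i j : `|A i j| <= enorm A.
Proof.
rewrite -sqrtr_sqr ler_sqrt; last first.
  by do 2![apply: sumr_ge0 => ? _]; rewrite sqr_ge0.
rewrite (bigD1 i) //= (bigD1 j) //= -addrA lerDl addr_ge0 //.
  by apply: sumr_ge0 => ? _; rewrite sqr_ge0.
by do 2![apply: sumr_ge0 => ? _]; rewrite sqr_ge0.
Qed.

Lemma dotc_enorm (R : realType) n (f : 'cV[R]_n) : dotc f f = enorm f ^+ 2.
Proof. by rewrite enorm_col sqr_sqrtr // dotc_ge0. Qed.

Lemma enorm_gt0 (R : realType) n (f : 'cV[R]_n) : f != 0 -> 0 < enorm f.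
Proof. by move=> f0; rewrite enorm_col sqrtr_gt0 lt0r dotc_eq0 f0 dotc_ge0. Qed.

Lemma cauchy_schwarz (R : realType) n (f g : 'cV[R]_n) :
  dotc f g <= enorm f * enorm g.
Proof.
have [->|f0] := eqVneq f 0.
  by rewrite dotcC /dotc mulmx0 mxE mulr_ge0 ?enorm_ge0.
have ef := enorm_gt0 f0.
(* Up to scaling this vector is the component of [g] orthogonal to [f]; its squared norm is
   [enorm f ^+ 2] times the gap in the squared inequality. *)
have := dotc_ge0 (dotc f g *: f - enorm f ^+ 2 *: g).
rewrite -[- _]scaleN1r !(dotcDl, dotcDr, dotcZl, dotcZr) (dotcC g f) !dotc_enorm.
have -> : forall a b c : R,
   a * (a * b ^+ 2) + a * (-1 * (b ^+ 2 * a)) +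
   (-1 * (b ^+ 2 * (a * a)) + -1 * (b ^+ 2 * (-1 * (b ^+ 2 * c ^+ 2)))) =
   b ^+ 2 * ((b * c) ^+ 2 - a ^+ 2) by move=> a b c; ring.
rewrite pmulr_rge0 ?exprn_gt0 // subr_ge0 => fg.
apply: le_trans (ler_norm _) _.
by rewrite -(ler_pXn2r (n := 2)) ?nnegrE ?mulr_ge0 ?enorm_ge0 // real_normK ?num_real.
Qed.

(** The left kernel of a single column has dimension at least [n - 1]. This makes the set defining
    [sigma] nonempty, without which its supremum would carry no information. *)
Lemma orthogonal_exists (R : fieldType) n (phi : 'cV[R]_n) : (1 < n)%N ->
  exists2 f : 'cV[R]_n, f != 0 & dotc f phi = 0.
Proof.
move=> n1; have : kermx phi != 0.
  by rewrite -mxrank_eq0 mxrank_ker subn_eq0 -ltnNge (leq_ltn_trans (rank_leq_col _)).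
case/rowV0Pn => v /sub_kermxP v0 vn0; exists v^T; first by rewrite trmx_eq0.
by rewrite /dotc trmxK v0 mxE.
Qed.

(** * The operator norm on the complement of a vector *)

Section RestrictedNorm.
Variables (R : realType) (n : nat) (L : 'M[R]_n) (phi : 'cV[R]_n) (b : R).
Hypothesis n1 : (1 < n)%N.
Hypothesis Lb : forall f, dotc f phi = 0 -> dotc (L *m f) (L *m f) <= b * dotc f f.

Definition quotients : set R := [set q | exists f : 'cV[R]_n,
  [/\ f != 0, f^T *m phi = 0 :> 'M_1 & q = enorm (L *m f) / enorm f]]%classic.

Lemma quotients_dotc f : (f^T *m phi = 0 :> 'M_1) <-> dotc f phi = 0.
Proof.
rewrite /dotc; split=> [->|f0]; first by rewrite mxE.
by apply/matrixP=> i j; rewrite !ord1 f0 mxE.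
Qed.

Lemma quotients_ub q : quotients q -> q <= Num.sqrt b.
Proof.
move=> [f [f0 /quotients_dotc fphi ->]].
rewrite ler_pdivrMr ?enorm_gt0 // !enorm_col mulrC -sqrtrM ?dotc_ge0 //.
by rewrite ler_wsqrtr // mulrC Lb.
Qed.

Lemma quotients_neq0 : (quotients !=set0)%classic.
Proof.
have [f f0 /quotients_dotc fphi] := orthogonal_exists phi n1.
by exists (enorm (L *m f) / enorm f), f.
Qed.

Lemma sup_quotients_le : sup quotients <= Num.sqrt b.
Proof. by apply: ge_sup quotients_neq0 _ => q; apply: quotients_ub. Qed.

Lemma le_sup_quotients f : dotc f phi = 0 ->
  enorm (L *m f) <= sup quotients * enorm f.
Proof.
move=> fphi; have [->|f0] := eqVneq f 0.
  by rewrite mulmx0 enorm_col /dotc mulmx0 mxE sqrtr0 mulr0.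
rewrite -ler_pdivrMr ?enorm_gt0 //; apply: ub_le_sup.
  by exists (Num.sqrt b) => q; apply: quotients_ub.
by exists f; split=> //; apply/quotients_dotc.
Qed.

Lemma sup_quotients_ge0 : 0 <= sup quotients.
Proof.
have [f f0 fphi] := orthogonal_exists phi n1.
rewrite -(pmulr_lge0 _ (enorm_gt0 f0)).
exact: le_trans (enorm_ge0 _) (le_sup_quotients fphi).
Qed.

(* [L^T] restricted to the complement of [phi] is the adjoint of the restriction
   of [L], hence has the same norm; distributions are row vectors, so this is the
   side on which the walk acts. *)
Hypothesis Lphi : L *m phi = phi.

Lemma le_sup_quotients_tr f : dotc f phi = 0 ->
  enorm (L^T *m f) <= sup quotients * enorm f.
Proof.
move=> fphi; have [e0|/enorm_gt0 e0] := eqVneq (L^T *m f) 0.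
  rewrite e0 enorm_col /dotc mulmx0 mxE sqrtr0 mulr_ge0 ?enorm_ge0 //.
  exact: sup_quotients_ge0.
(* The squared norm of [L^T *m f] is the inner product of [L *m (L^T *m f)] with [f]. Cauchy-Schwarz
   and the bound for [L] apply, [L^T *m f] being orthogonal to [phi] because [L] fixes [phi]; one
   factor [enorm (L^T *m f)] then cancels. *)
rewrite -(ler_pM2r e0) -expr2 -dotc_enorm dotc_mulmxr trmxK.
apply: le_trans (cauchy_schwarz _ _) _; rewrite mulrAC ler_wpM2r ?enorm_ge0 //.
by rewrite le_sup_quotients // dotcC dotc_mulmxr trmxK Lphi dotcC.
Qed.

Lemma enorm_iter_le (g : nat -> 'rV[R]_n) k :
  (forall i, g i.+1 = g i *m L) -> g 0%N *m phi = 0 ->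
  enorm (g k) <= sup quotients ^+ k * enorm (g 0%N).
Proof.
move=> gS g0; have gphi i : g i *m phi = 0.
  by elim: i => // i IHi; rewrite gS -mulmxA Lphi.
elim: k => [|k IHk]; first by rewrite expr0 mul1r.
rewrite gS -enorm_tr trmx_mul exprS -mulrA.
apply: le_trans (le_sup_quotients_tr _) _.
  by rewrite /dotc trmxK gphi mxE.
by rewrite enorm_tr ler_wpM2l // sup_quotients_ge0.
Qed.

End RestrictedNorm.

(** * The lazy operator of an Eulerian weighted digraph *)

Section LazyWalk.
Variables (R : realType) (n : nat) (A : 'M[R]_n) (t : 'rV[R]_n).
Hypothesis A_ge0 : forall i j, 0 <= A i j.
Hypothesis t_gt0 : forall i, 0 < t 0 i.
Hypothesis outA : forall i, \sum_j A i j = t 0 i.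
Hypothesis inA : forall j, \sum_i A i j = t 0 j.
Variable alpha : R.
Hypotheses (alpha_gt0 : 0 < alpha) (alpha_lt1 : alpha < 1).

Definition lazy : 'M[R]_n := alpha%:M + (1 - alpha) *: normalized A t.

Lemma normalized_tr : (normalized A t)^T = normalized A^T t.
Proof. by rewrite /normalized !trmx_mul !tr_diag_mx mulmxA. Qed.

Lemma normalized_tr_top : (normalized A t)^T *m top_vector t = top_vector t.
Proof.
rewrite normalized_tr normalized_top // => i.
by under eq_bigr do rewrite mxE; rewrite inA.
Qed.

Lemma lazy_top : lazy *m top_vector t = top_vector t.
Proof.
rewrite mulmxDl mul_scalar_mx -scalemxAl normalized_top //.
by rewrite -scalerDl addrC subrK scale1r.
Qed.

Local Notation lambda := (nth 0 (eigenvalues (normalized_laplacian A t)) 1).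

Lemma top_vector_neq0 : (0 < n)%N -> top_vector t != 0.
Proof.
move=> n0; apply: contraTneq isT => /colP/(_ (Ordinal n0)) /eqP.
by rewrite /top_vector mul_diag_mx !mxE mulr1 gt_eqF // sqrtr_gt0.
Qed.

Lemma laplacian_top : normalized_laplacian A t *m top_vector t = 0.
Proof.
rewrite /normalized_laplacian -scalemxAl linearB /= trmx1 mulmxDl !mulmxBl.
by rewrite mul1mx normalized_top // normalized_tr_top subrr addr0 scaler0.
Qed.

Lemma lazy_contraction f : (0 < n)%N -> dotc f (top_vector t) = 0 ->
  dotc (lazy *m f) (lazy *m f) <=
  (1 - 2 * alpha * (1 - alpha) * lambda) * dotc f f.
Proof.
move=> n0 fphi.
have := rayleigh_second_eigenvalue (laplacian_sym A t)
  (laplacian_ge0 A_ge0 t_gt0 outA inA) (top_vector_neq0 n0) laplacian_top fphi.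
rewrite dotc_laplacian; have := normalized_contraction A_ge0 t_gt0 outA inA f.
rewrite /lazy mulmxDl mul_scalar_mx -scalemxAl !(dotcDl, dotcDr, dotcZl, dotcZr).
rewrite (dotcC (_ *m f) f).
set x := dotc f f; set y := dotc f _; set z := dotc _ _; set l := lambda => zx lxy.
rewrite -subr_ge0.
(* The slack splits into a multiple of the Rayleigh gap [x - y - l * x] and a multiple of the
   contraction gap [x - z], both nonnegative. *)
have -> : (1 - 2 * alpha * (1 - alpha) * l) * x - (alpha * (alpha * x) +
   alpha * ((1 - alpha) * y) + ((1 - alpha) * (alpha * y) +
   (1 - alpha) * ((1 - alpha) * z))) = 2 * (alpha * (1 - alpha)) * (x - y - l * x) +
   (1 - alpha) ^+ 2 * (x - z) by ring.
have a1 : 0 <= 1 - alpha by rewrite subr_ge0 ltW.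
by rewrite addr_ge0 ?mulr_ge0 ?subr_ge0 // ltW.
Qed.

(** Connectivity enters as: a function constant along arcs is constant. If the Dirichlet form of
    [diag_sqrt t *m g] is nonpositive, each of its nonnegative terms vanishes, so [g] is constant
    along arcs and the vector is a multiple of [top_vector t]. *)
Lemma lambda_gt0 : (1 < n)%N ->
  (forall g : 'I_n -> R, (forall i j, A i j != 0 -> g i = g j) ->
     forall i j, g i = g j) ->
  0 < lambda.
Proof.
move=> n1 conn; apply: (second_eigenvalue_gt0 (phi := top_vector t)) => // [|f fle].
  exact: laplacian_sym.
have [g fE] : exists g, f = diag_sqrt t *m g.
  by exists (diag_invsqrt t *m f); rewrite mulmxA diag_sqrtK ?mul1mx.
have i0 : 'I_n by apply: Ordinal (ltnW n1).
exists (g i0 0); rewrite {1}fE /top_vector scalemxAr; congr (_ *m _).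
apply/colP=> i; rewrite !mxE mulr1; apply: (conn (fun i => g i 0)) => {}i j Aij.
have : \sum_i \sum_j A i j * (g i 0 - g j 0) ^+ 2 <= 0.
  by move: fle; rewrite fE dirichlet_form // pmulr_rle0 ?invr_gt0.
have ge0 k l : 0 <= A k l * (g k 0 - g l 0) ^+ 2 by rewrite mulr_ge0 ?sqr_ge0.
have ge0' k : 0 <= \sum_l A k l * (g k 0 - g l 0) ^+ 2 by apply: sumr_ge0.
rewrite le_eqVlt ltNge sumr_ge0 // orbF psumr_eq0 // => /allP/(_ i (mem_index_enum _)).
rewrite psumr_eq0 // => /allP/(_ j (mem_index_enum _)).
by rewrite mulf_eq0 (negPf Aij) expf_eq0 /= subr_eq0 => /eqP.
Qed.

End LazyWalk.

(** * The digraph on stops *)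

Section Stops.
Variables (V : finType) (E : {set {set V}}) (r s : nat).
Hypotheses (hrs : (r < 2 * s)%N) (hsr : (s < r)%N) (hE : uniform E r).

Lemma size_stop (x : stop V s) : size x = s.
Proof. exact: size_tuple. Qed.

Lemma uniq_stop (x : stop V s) : uniq x.
Proof. exact: (valP x). Qed.

Lemma stop_inj : injective (@seq_of_stop V s).
Proof. by move=> x y xy; apply: val_inj; apply: val_inj. Qed.

Lemma stop_exists (l : seq V) : size l = s -> uniq l ->
  exists x : stop V s, x = l :> seq V.
Proof.
move=> /eqP sl ul.
by exists (Sub (Tuple sl) ul : stop V s); rewrite /seq_of_stop SubK.
Qed.

Lemma card_stop_set (x : stop V s) : #|stop_set x| = s.
Proof.
by rewrite /stop_set cardsE; have /card_uniqP -> := uniq_stop x; rewrite size_stop.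
Qed.

(** The map [U] to [S :|: U] is a bijection onto the edges containing [S], with inverse [e] to
    [e :\: S]. *)
Lemma card_link (S : {set V}) : #|link E S| = deg E S.
Proof.
rewrite /deg.
have -> : [set e in E | S \subset e] = (fun U => S :|: U) @: link E S.
  apply/setP=> e; rewrite !inE; apply/andP/imsetP => [[eE Se]|[U + ->]].
    have SeE : S :|: (e :\: S) = e.
      apply/setP=> v; rewrite !inE.
      by have [/(fintype.subsetP Se) ->|] := boolP (v \in S).
    exists (e :\: S); rewrite ?inE ?SeE // eE andbT -setI_eq0.
    by apply/eqP/setP=> v; rewrite !inE; case: (v \in S); rewrite ?andbF.
  by rewrite inE => /andP[_ ->]; rewrite finset.subsetUl.
rewrite card_in_imset // => U W; rewrite !inE => /andP[dU _] /andP[dW _] UW.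
have cancelS (T : {set V}) : [disjoint S & T] -> (S :|: T) :\: S = T.
  by rewrite disjoint_sym finset.setDUl finset.setDv finset.set0U => /finset.setDidPl.
by rewrite -(cancelS U) // UW cancelS.
Qed.

Lemma card_in_link (x : stop V s) U : U \in link E (stop_set x) -> #|U| = (r - s)%N.
Proof.
rewrite inE => /andP[dSU /hE]; rewrite cardsU disjoint_setI0 // cards0 subn0.
by rewrite card_stop_set => <-; rewrite addKn.
Qed.

Lemma card_orderings (U : {set V}) : #|U| = (r - s)%N ->
  #|orderings r s U| = (r - s)`!.
Proof.
move=> cU; transitivity (#|U| ^_ (r - s)); last by rewrite cU ffactnn.
rewrite -card_uniq_tuples; apply: eq_card => w.
rewrite !inE andbC; case: (boolP (uniq w)) => uw; rewrite ?andbF // !andbT.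
rewrite eqEcard cU cardsE; have /card_uniqP -> := uw.
rewrite size_tuple leqnn andbT; apply/fintype.subsetP/allP => wU v.
  by move=> vw; apply: wU; rewrite inE.
by rewrite inE; apply: wU.
Qed.

(** The default of [insubd] is never returned, since reversing preserves distinctness. *)
Definition rev_stop (x : stop V s) : stop V s :=
  insubd x (rev_tuple (sval x)).

Lemma rev_stopE (x : stop V s) : rev_stop x = rev x :> seq V.
Proof.
rewrite /rev_stop /seq_of_stop val_insubd /= rev_uniq.
by rewrite (valP x).
Qed.

Lemma rev_stopK : involutive rev_stop.
Proof. by move=> x; apply: stop_inj; rewrite !rev_stopE revK. Qed.

Lemma rev_stop_set x : stop_set (rev_stop x) = stop_set x.
Proof. by apply/setP=> v; rewrite !inE rev_stopE mem_rev. Qed.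

Lemma stop_arc_rev x y : stop_arc E r (rev_stop x) (rev_stop y) = stop_arc E r y x.
Proof.
rewrite /stop_arc !rev_stop_set !rev_stopE finset.setUC; congr (_ && _).
rewrite -[take _ (rev y)]revK take_rev revK drop_rev !size_stop (inj_eq (can_inj revK)).
by rewrite eq_sym; congr (_ == _); [congr drop | congr take]; lia.
Qed.

(** [stop_arc] asks only for an edge, while [link] also asks for disjointness. The latter follows by
    counting: the edge has [r] vertices, which is the sum of the sizes [s] and [r - s] of the two
    pieces. *)
Lemma stop_arc_link (x y : stop V s) :
  drop (r - s) x = take (2 * s - r) y ->
  ([set v in drop (2 * s - r) y] \in link E (stop_set x)) =
  (stop_set x :|: stop_set y \in E).
Proof.
move=> xy; set U := [set v in _].
have xU : stop_set x :|: U = stop_set x :|: stop_set y.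
  apply/setP=> v; rewrite !inE -{2}(cat_take_drop (2 * s - r) y) mem_cat -xy.
  by have := @mem_drop (r - s) _ x v; case: (v \in drop _ _) => // ->.
rewrite inE xU; case: (boolP (_ \in E)) => [xyE|]; rewrite ?andbF ?andbT //.
have cU : #|U| = (r - s)%N.
  rewrite cardsE; have /card_uniqP -> : uniq (drop (2 * s - r) y).
    exact: drop_uniq (uniq_stop y).
  by rewrite size_drop size_stop; lia.
have := hE xyE; rewrite -xU cardsU card_stop_set cU => cxU.
rewrite -setI_eq0 -cards_eq0; lia.
Qed.

Variable R : realType.

(** At most one term survives: [w] must consist of the last [r - s] entries of [y], and [U] must be
    their set. *)
Lemma step_count (x y : stop V s) :
  \sum_(U in link E (stop_set x)) \sum_(w in orderings r s U)
    ((y : seq V) == drop (r - s) x ++ w)%:R = (stop_arc E r x y)%:R :> R.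
Proof.
have sw0 : size (drop (2 * s - r) y) == (r - s)%N.
  by rewrite size_drop size_stop; lia.
pose w0 := Tuple sw0.
have E0 (w : (r - s).-tuple V) : ((y : seq V) == drop (r - s) x ++ w) =
    (drop (r - s) x == take (2 * s - r) y) && (w == w0).
  rewrite -{1}(cat_take_drop (2 * s - r) y) eqseq_cat; last first.
    by rewrite size_take size_drop !size_stop; case: ifP; lia.
  by rewrite eq_sym [drop _ y == _]eq_sym.
under eq_bigr => U _ do under eq_bigr => w _ do rewrite E0.
rewrite /stop_arc; case: eqP => [xy|_] /=; last first.
  by rewrite big1 // => U _; rewrite big1.
rewrite -stop_arc_link //.
have w0P U : (w0 \in orderings r s U) = (U == [set v in drop (2 * s - r) y]).
  by rewrite inE (drop_uniq _ (uniq_stop y)) eq_sym.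
transitivity (\sum_(U in link E (stop_set x)) (w0 \in orderings r s U)%:R : R).
  apply: eq_bigr => U _; case: (boolP (w0 \in _)) => w0U.
    by rewrite (bigD1 w0) //= eqxx big1 ?addr0 // => w /andP[_ /negPf ->].
  rewrite big1 // => w wU; case: eqP => // ww0.
  by rewrite ww0 (negPf w0U) in wU.
under eq_bigr => U _ do rewrite w0P.
set U0 := [set v in _]; case: (boolP (U0 \in _)) => U0l.
  by rewrite (bigD1 U0) //= eqxx big1 ?addr0 // => U /andP[_ /negPf ->].
rewrite big1 // => U Ul; case: eqP => // UU0.
by rewrite UU0 (negPf U0l) in Ul.
Qed.

Lemma stepE (x y : stop V s) :
  step E R r x y = (stop_arc E r x y)%:R / (stop_deg E r x)%:R.
Proof.
rewrite -step_count mulr_suml; apply: eq_bigr => U Ul.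
rewrite mulr_sumr mulr_suml; apply: eq_bigr => w wU.
rewrite card_link (card_orderings (card_in_link Ul)) /stop_deg natrM invfM.
by rewrite mulrA mulrC.
Qed.

(** Summing over [y] first, each pair of [U] and [w] yields exactly one stop; what remains are two
    uniform averages of 1, over sets of positive size. *)
Lemma step_sum1 (x : stop V s) : (0 < deg E (stop_set x))%N ->
  \sum_y step E R r x y = 1.
Proof.
move=> dx; rewrite /step exchange_big /=.
transitivity (\sum_(U in link E (stop_set x)) #|link E (stop_set x)|%:R^-1 : R).
  apply: eq_bigr => U Ul; rewrite -mulr_sumr exchange_big /=.
  rewrite -[RHS]mulr1; congr (_ * _).
  have cU := card_orderings (card_in_link Ul).
  transitivity (\sum_(w in orderings r s U) #|orderings r s U|%:R^-1 : R).
    apply: eq_bigr => w wU; rewrite -mulr_sumr -[RHS]mulr1; congr (_ * _).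
    have [||z zE] := @stop_exists (drop (r - s) x ++ w).
    - by rewrite size_cat size_drop size_stop size_tuple; lia.
    - move: wU Ul; rewrite !inE => /andP[uw /eqP wU] /andP[/pred0P dU _].
      rewrite cat_uniq (drop_uniq _ (uniq_stop x)) uw andbT /=.
      apply/hasPn => v vw; apply/negP => /mem_drop vx.
      by have := dU v; rewrite /= -wU !inE vw vx.
    rewrite (bigD1 z) //= zE eqxx big1 ?addr0 // => y yz.
    by rewrite -zE (inj_eq stop_inj) (negPf yz).
  by rewrite sumr_const cU -[LHS]mulr_natl mulfV // pnatr_eq0 -lt0n fact_gt0.
by rewrite sumr_const card_link -[LHS]mulr_natl mulfV // pnatr_eq0 -lt0n.
Qed.

End Stops.

(** * Walks, connectivity and degrees *)

Section Walks.
Variables (V : finType) (E : {set {set V}}) (r s : nat).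
Hypotheses (hrs : (r < 2 * s)%N) (hsr : (s < r)%N).
Hypothesis hE : uniform E r.

(** Consecutive stops are the first and the last [s] vertices of one edge of the walk. They overlap
    in [2 * s - r] vertices and together cover the edge. *)
Lemma walk_arc k v i : is_walk E r s k v -> (i < k)%N ->
  exists x y : stop V s,
    [/\ walk_stop r s v i = x, walk_stop r s v i.+1 = y & stop_arc E r x y].
Proof.
move=> [sv wv] ik; have [] := wv i ik.
rewrite /walk_stop /walk_edge mulnS.
have [l le] : exists l, l = drop ((r - s) * i) v by eexists.
have sl : (r <= size l)%N.
  have := leq_mul (leqnn (r - s)) ik.
  by rewrite le size_drop sv mulnS; lia.
rewrite -drop_drop -le.
have -> : take s l = take s (take r l) by rewrite take_takel // ltnW.
have -> : take s (drop (r - s) l) = drop (r - s) (take r l).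
  by rewrite take_drop subnKC // ltnW.
have : size (take r l) = r by rewrite size_takel.
move: (take r l) => w sw uw wE.
have [|x xE] := @stop_exists V s (take s w) _ (take_uniq _ uw).
  by rewrite size_takel // sw ltnW.
have [|y yE] := @stop_exists V s (drop (r - s) w) _ (drop_uniq _ uw).
  by rewrite size_drop sw; lia.
exists x, y; split=> //; rewrite /stop_arc xE yE take_drop.
have -> : (2 * s - r + (r - s))%N = s by lia.
rewrite eqxx /=; congr (_ \in E): wE; apply/setP=> u; rewrite !inE xE yE.
apply/idP/orP => [|[/mem_take|/mem_drop]] //.
rewrite -{1}(cat_take_drop s w) mem_cat => /orP[|]; first by left.
have -> : drop s w = drop (s - (r - s)) (drop (r - s) w).
  by rewrite drop_drop; congr drop; lia.
by move/mem_drop; right.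
Qed.

Hypothesis hconn : connected_by_walks E r s.

Lemma stop_connected (T : Type) (g : stop V s -> T) :
  (forall x y, stop_arc E r x y -> g x = g y) -> forall x y, g x = g y.
Proof.
move=> gP x y; have [k [v [wv v0 vk]]] := hconn x y.
suff H i : (i <= k)%N -> exists2 z : stop V s, walk_stop r s v i = z & g x = g z.
  have [z vz ->] := H k (leqnn k); congr g.
  by apply: stop_inj; rewrite -vz.
elim: i => [_|i IHi ik]; first by exists x.
have [z vz ->] := IHi (ltnW ik).
have [z1 [z2 [z1E z2E /gP z12]]] := walk_arc wv ik.
exists z2 => //; rewrite -z12; congr g.
by apply: stop_inj; rewrite -vz.
Qed.

Hypothesis s1 : (1 < s)%N.

(** For [s > 1] the first and last coordinates are distinct. The reversal thus serves as a second
    stop whenever one different from [x] is wanted. *)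
Lemma rev_stop_neq (x : stop V s) : rev_stop x != x.
Proof.
apply/negP => /eqP /(congr1 (@seq_of_stop V s)); rewrite rev_stopE => rx.
have v0 : V.
  by case: (seq_of_stop x) (size_stop x) => [|v0 //] s0; move: s1; rewrite -s0.
have := nth_uniq v0 _ _ (uniq_stop x) => /(_ 0 s.-1).
rewrite !size_stop; have s0 := ltnW s1.
rewrite s0 prednK // leqnn => /(_ isT isT).
by rewrite -{1}rx nth_rev ?size_stop // subn1 eqxx; case: (s) s1 => [|[]].
Qed.

(** A walk from [x] to its reversal has positive length, so its first edge contains [x]. *)
Lemma deg_gt0 (x : stop V s) : (0 < deg E (stop_set x))%N.
Proof.
have [k [v [wv v0 vk]]] := hconn x (rev_stop x).
have k0 : (0 < k)%N.
  rewrite lt0n; apply: contra (rev_stop_neq x) => /eqP k0.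
  by apply/eqP/stop_inj; rewrite -vk k0.
have [y [z [yE zE /andP[_ yzE]]]] := walk_arc wv k0.
have yx : y = x by apply: stop_inj; rewrite -yE -v0.
apply/card_gt0P; exists (stop_set y :|: stop_set z).
by rewrite inE yzE yx finset.subsetUl.
Qed.

Variable R : realType.

Lemma stop_deg_gt0 (x : stop V s) : 0 < (stop_deg E r x)%:R :> R.
Proof. by rewrite ltr0n muln_gt0 deg_gt0 fact_gt0. Qed.

(** No separate count of arcs is made: the step probabilities sum to 1, and each is an arc indicator
    divided by the degree. *)
Lemma out_degree (x : stop V s) :
  \sum_y (stop_arc E r x y)%:R = (stop_deg E r x)%:R :> R.
Proof.
have := step_sum1 hrs hsr hE R (deg_gt0 x).
under eq_bigr => y _ do rewrite (stepE hrs hsr hE).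
rewrite -mulr_suml => /(congr1 ( *%R^~ (stop_deg E r x)%:R)).
by rewrite mulfVK ?mul1r // gt_eqF // stop_deg_gt0.
Qed.

Lemma in_degree (y : stop V s) :
  \sum_x (stop_arc E r x y)%:R = (stop_deg E r y)%:R :> R.
Proof.
transitivity ((stop_deg E r (rev_stop y))%:R : R); last first.
  by rewrite /stop_deg rev_stop_set.
rewrite -out_degree [RHS](reindex_inj (can_inj (@rev_stopK V s))).
by apply: eq_bigr => x _; rewrite (stop_arc_rev E hrs hsr).
Qed.

End Walks.

(** * The law of the stops as a Markov recursion *)

Section Trajectories.
Variables (V : finType) (E : {set {set V}}) (r s : nat) (R : realType).
Variables (alpha : R) (f0 : stop V s -> R).

Lemma stop_distr0 x : stop_distr E r alpha f0 0 x = f0 x.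
Proof.
rewrite /stop_distr (big_pred1 [ffun=> x]) => [|w /=].
  by rewrite /trajectory_prob big_ord0 mulr1 ffunE.
apply/eqP/eqP => [wx|->]; last by rewrite ffunE.
by apply/ffunP => i; rewrite ffunE -wx (ord1 i) (ord1 ord_max).
Qed.

(** Appending [y] ([h]) and deleting the last stop ([h']) match trajectories ending at [y] with
    shorter ones. Grouping the latter by their last stop [x] lets the final factor of the product
    come out. *)
Lemma stop_distrS k y : stop_distr E r alpha f0 k.+1 y =
  \sum_x stop_distr E r alpha f0 k x * lazy_step E r alpha x y.
Proof.
pose h (w : {ffun 'I_k.+1 -> stop V s}) : {ffun 'I_k.+2 -> stop V s} :=
  [ffun i => if unlift ord_max i is Some j then w j else y].
pose h' (w : {ffun 'I_k.+2 -> stop V s}) : {ffun 'I_k.+1 -> stop V s} :=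
  [ffun j => w (lift ord_max j)].
have widenE (j : 'I_k.+1) le : widen_ord le j = lift ord_max j :> 'I_k.+2.
  by apply: ord_inj; rewrite lift_max.
have hW w j : h w (lift ord_max j) = w j by rewrite ffunE liftK.
have hM w : h w ord_max = y by rewrite ffunE unlift_none.
rewrite /stop_distr (reindex_onto h h') => [|w /eqP wy]; last first.
  apply/ffunP=> i; rewrite ffunE; case: unliftP => [j ->|->] //.
  by rewrite ffunE.
rewrite (eq_bigl predT) => [|w]; last first.
  by rewrite hM eqxx; apply/eqP/ffunP=> j; rewrite ffunE hW.
rewrite (partition_big (fun w : {ffun 'I_k.+1 -> _} => w ord_max) predT) //=.
apply: eq_bigr => x _; rewrite mulr_suml; apply: eq_bigr => w /eqP wx.
rewrite /trajectory_prob big_ord_recr /= mulrA; congr (_ * _ * _).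
- have -> : ord0 = lift ord_max ord0 :> 'I_k.+2 by apply: ord_inj; rewrite lift_max.
  by rewrite hW.
- apply: eq_bigr => i _; congr lazy_step; first by rewrite widenE hW.
  have -> : lift ord0 (widen_ord (leqnSn k) i) = lift ord_max (lift ord0 i) :> 'I_k.+2.
    by apply: ord_inj; rewrite lift_max.
  by rewrite hW.
congr lazy_step; first by rewrite widenE hW.
by have -> : lift ord0 ord_max = ord_max :> 'I_k.+2 by apply: val_inj.
Qed.

End Trajectories.

(** * The lazy walk on stops *)

Section LazyStopWalk.
Variables (R : realType) (V : finType) (r s : nat) (E : {set {set V}}).
Hypotheses (s1 : (1 < s)%N) (hrs : (r < 2 * s)%N) (hsr : (s < r)%N).
Hypotheses (hE : uniform E r) (hconn : connected_by_walks E r s).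
Variable alpha : R.
Hypotheses (alpha_gt0 : 0 < alpha) (alpha_lt1 : alpha < 1).

Local Notation N := #|{: stop V s}|.

Definition stop_degrees : 'rV[R]_N := row_of (fun x : stop V s => (stop_deg E r x)%:R).

Local Notation A := (adjacency E R r s).
Local Notation t := stop_degrees.

Lemma sum_stops (F : stop V s -> R) : \sum_(i < N) F (enum_val i) = \sum_x F x.
Proof. by rewrite -(big_enum_val F). Qed.

Lemma adjacency_ge0 i j : 0 <= A i j.
Proof. by rewrite mxE ler0n. Qed.

Lemma stop_degrees_gt0 i : 0 < t 0 i.
Proof. by rewrite mxE (stop_deg_gt0 hrs hsr hconn s1). Qed.

Lemma adjacency_out i : \sum_j A i j = t 0 i.
Proof.
under eq_bigr do rewrite mxE.
by rewrite (sum_stops (fun y => (stop_arc E r (enum_val i) y)%:R)) mxE out_degree.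
Qed.

Lemma adjacency_in j : \sum_i A i j = t 0 j.
Proof.
under eq_bigr do rewrite mxE.
by rewrite (sum_stops (fun x => (stop_arc E r x (enum_val j))%:R)) mxE in_degree.
Qed.

Lemma sqrtTE : sqrtT E R r s = diag_sqrt t.
Proof. by congr diag_mx; apply/rowP=> i; rewrite !mxE. Qed.

Lemma invsqrtTE : invsqrtT E R r s = diag_invsqrt t.
Proof. by congr diag_mx; apply/rowP=> i; rewrite !mxE. Qed.

Lemma laplacianE : laplacian E R r s = normalized_laplacian A t.
Proof. by rewrite /laplacian /dir_laplacian invsqrtTE. Qed.

Lemma lazy_mxE : lazy_mx E r s alpha = lazy A t alpha.
Proof. by rewrite /lazy_mx invsqrtTE. Qed.

Lemma sigmaE : sigma E r s alpha = sup (quotients (lazy A t alpha) (top_vector t)).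
Proof. by rewrite /sigma sqrtTE lazy_mxE. Qed.

(** The inverse degree matrix is written as a product of two copies of [diag_invsqrt t], so that the
    similarity with [lazy] is purely formal. *)
Definition transition : 'M[R]_N :=
  alpha%:M + (1 - alpha) *: (diag_invsqrt t *m (diag_invsqrt t *m A)).

Lemma transitionE i j :
  transition i j = lazy_step E r alpha (enum_val i) (enum_val j).
Proof.
rewrite /transition !mul_diag_mx !mxE /lazy_step (stepE hrs hsr hE).
rewrite (inj_eq enum_val_inj) -[alpha *+ _]mulr_natr; congr (_ + _ * _).
by rewrite mulrA -invfM -expr2 sqr_sqrtr ?ler0n // mulrC.
Qed.

Lemma transition_diag_invsqrt :
  transition *m diag_invsqrt t = diag_invsqrt t *m lazy A t alpha.
Proof.
rewrite mulmxDl mulmxDr mul_scalar_mx mul_mx_scalar -scalemxAl -scalemxAr.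
by rewrite /normalized !mulmxA.
Qed.

(** The degree weight of [x] cancels the denominator of the step probability, leaving the in-degree
    of the target, which equals its out-degree. *)
Lemma stationary_transition (pi := row_of (stationary E R r (s := s))) :
  pi *m transition = pi.
Proof.
apply/rowP=> j; rewrite !mxE /stationary.
under eq_bigr => i _ do rewrite transitionE mxE.
rewrite (sum_stops (fun x => stationary E R r x * lazy_step E r alpha x (enum_val j))).
rewrite /stationary; pose D : R := \sum_(y : stop V s) (stop_deg E r y)%:R.
rewrite -!/D.
under eq_bigr => x _ do rewrite mulrAC /lazy_step mulrDr (stepE hrs hsr hE).
rewrite -mulr_suml; congr (_ / _); rewrite big_split /=.
have -> : \sum_x (stop_deg E r x)%:R * ((1 - alpha) *
    ((stop_arc E r x (enum_val j))%:R / (stop_deg E r x)%:R)) =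
    (1 - alpha) * (stop_deg E r (enum_val j))%:R.
  rewrite -(in_degree hrs hsr hE hconn s1) mulr_sumr; apply: eq_bigr => x _.
  by rewrite mulrCA [_ / _]mulrC mulVKf // gt_eqF // (stop_deg_gt0 hrs hsr hconn s1).
rewrite (bigD1 (enum_val j)) //= eqxx mulr1 big1 => [|x /negPf ->]; last first.
  by rewrite !mulr0.
by rewrite addr0 mulrC -mulrDl addrC subrK mul1r.
Qed.

Variable f0 : stop V s -> R.

Definition deviation k : 'rV[R]_N :=
  (row_of (stop_distr E r alpha f0 k) - row_of (stationary E R r (s := s)))
    *m diag_invsqrt t.

Lemma deviationS k : deviation k.+1 = deviation k *m lazy A t alpha.
Proof.
rewrite /deviation -mulmxA -transition_diag_invsqrt mulmxA; congr (_ *m _).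
rewrite mulmxBl stationary_transition; congr (_ - _).
apply/rowP=> j; rewrite !mxE stop_distrS.
under [RHS]eq_bigr => i _ do rewrite transitionE mxE.
by rewrite (sum_stops (fun x => stop_distr E r alpha f0 k x *
  lazy_step E r alpha x (enum_val j))).
Qed.

Hypothesis f0_distr : \sum_x f0 x = 1.
Hypothesis N1 : (1 < N)%N.

(** The two square-root matrices cancel, so the product is the difference of the total masses of
    [f0] and of the stationary distribution, both 1. *)
Lemma deviation0_top : deviation 0 *m top_vector t = 0.
Proof.
rewrite /deviation /top_vector mulmxA -(mulmxA _ _ (diag_sqrt t)).
rewrite (diag_invsqrtK stop_degrees_gt0) mulmx1.
apply/matrixP=> i j; rewrite !ord1 mulmxBl !mxE.
under eq_bigr do rewrite !mxE mulr1 stop_distr0.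
under [X in _ - X]eq_bigr do rewrite !mxE mulr1.
rewrite !sum_stops f0_distr /stationary -mulr_suml divff ?subrr //.
(* Some stop exists and has positive degree, so the normalising constant of the stationary
   distribution is nonzero. *)
have x0 : stop V s := enum_val (Ordinal (ltnW N1)).
rewrite gt_eqF // (bigD1 x0) //= ltr_pwDl ?(stop_deg_gt0 hrs hsr hconn s1) //.
by apply: sumr_ge0.
Qed.

Lemma sigma_le : sigma E r s alpha <=
  Num.sqrt (1 - 2 * alpha * (1 - alpha) * lambda1 E R r s).
Proof.
rewrite sigmaE /lambda1 laplacianE; apply: sup_quotients_le => // f fphi.
apply: lazy_contraction => //; first exact: adjacency_ge0.
- exact: stop_degrees_gt0.
- exact: adjacency_out.
- exact: adjacency_in.
exact: ltnW.
Qed.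

Lemma deviation_le k :
  enorm (deviation k) <= sigma E r s alpha ^+ k * enorm (deviation 0).
Proof.
rewrite sigmaE; apply: enorm_iter_le => //.
- move=> f fphi; apply: lazy_contraction fphi => //; first exact: adjacency_ge0.
  + exact: stop_degrees_gt0.
  + exact: adjacency_out.
  + exact: adjacency_in.
  exact: ltnW.
- exact: lazy_top stop_degrees_gt0 adjacency_out alpha.
- exact: deviationS.
exact: deviation0_top.
Qed.

Lemma lambda1_gt0 : 0 < lambda1 E R r s.
Proof.
rewrite /lambda1 laplacianE; apply: lambda_gt0 => //.
- exact: adjacency_ge0.
- exact: stop_degrees_gt0.
- exact: adjacency_out.
- exact: adjacency_in.
move=> g gP i j; rewrite -(enum_valK i) -(enum_valK j).
pose h x := g (enum_rank x); suff: forall x y, h x = h y by apply.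
apply: (stop_connected hrs hsr hconn (g := h)) => x y xy; rewrite /h.
by apply: gP; rewrite mxE !enum_rankK xy oner_eq0.
Qed.

Lemma sigma_lt1 : sigma E r s alpha < 1.
Proof.
apply: le_lt_trans sigma_le _.
rewrite -[ltRHS]sqrtr1 ltr_sqrt // gtrBl.
by rewrite !mulr_gt0 ?lambda1_gt0 // subr_gt0.
Qed.

Lemma sigma_ge0 : 0 <= sigma E r s alpha.
Proof.
rewrite sigmaE; apply: sup_quotients_ge0 => // f fphi.
apply: lazy_contraction fphi => //; first exact: adjacency_ge0.
- exact: stop_degrees_gt0.
- exact: adjacency_out.
- exact: adjacency_in.
exact: ltnW.
Qed.

Lemma stop_distr_deviation k x :
  stop_distr E r alpha f0 k x - stationary E R r x =
  deviation k 0 (enum_rank x) * Num.sqrt (stop_deg E r x)%:R.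
Proof.
rewrite /deviation mul_mx_diag !mxE enum_rankK mulfVK //.
by rewrite gt_eqF // sqrtr_gt0 (stop_deg_gt0 hrs hsr hconn s1).
Qed.

(** A single entry is bounded by the norm of the deviation times the square root of the degree,
    hence squeezed by a geometric sequence of ratio [sigma < 1]. *)
Lemma stop_distr_cvg x :
  (stop_distr E r alpha f0 k x @[k --> \oo] --> stationary E R r x)%classic.
Proof.
pose c := enorm (deviation 0) * Num.sqrt (stop_deg E r x)%:R.
pose q := sigma E r s alpha.
have q0 : (c * q ^+ k @[k --> \oo] --> 0)%classic.
  rewrite -(mulr0 c); apply: cvgMr; apply: cvg_expr.
  by rewrite ger0_norm ?sigma_ge0 // sigma_lt1.
apply/subr_cvg0; apply/norm_cvg0P.
apply: (@squeeze_cvgr _ _ _ _ (fun=> 0) (fun k => c * q ^+ k)) => //;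
  last exact: cvg_cst.
near=> k; rewrite normr_ge0 /= stop_distr_deviation normrM.
rewrite (ger0_norm (sqrtr_ge0 _)) /c mulrAC ler_wpM2r ?sqrtr_ge0 //.
apply: le_trans (enorm_entry _ _ _) _.
by rewrite mulrC deviation_le.
Unshelve. all: by end_near.
Qed.

End LazyStopWalk.

(** The first [s] elements of the enumeration of [V] form a stop, and its reversal is another. *)
Lemma stop_pairs (V : finType) s : (1 < s <= #|V|)%N -> (1 < #|{: stop V s}|)%N.
Proof.
move=> /andP[s1 sV].
have [||x _] := @stop_exists V s (take s (enum V)).
- by rewrite size_takel // -cardE.
- exact: take_uniq (enum_uniq _).
by apply/card_gt1P; exists (rev_stop x), x; rewrite rev_stop_neq.
Qed.

Local Open Scope classical_set_scope.

Theorem theorem10 (R : realType) (V : finType) (r s : nat)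
    (E : {set {set V}}) (alpha : R) (f0 : stop V s -> R)
    (hr : (3 <= r)%N) (hrs : (r < 2 * s)%N) (hsr : (s <= r - 1)%N)
    (hV : (r <= #|V|)%N) (hE : uniform E r)
    (hconn : connected_by_walks E r s)
    (halpha0 : 0 < alpha) (halpha1 : alpha < 1) (hf0 : is_distr f0) :
  let f := stop_distr E r alpha f0 in
  let pi : stop V s -> R := stationary E R r (s := s) in
  [/\ forall x : stop V s, (f k x @[k --> \oo] --> pi x),
      forall k : nat,
        enorm ((row_of (f k) - row_of pi) *m invsqrtT E R r s) <=
        sigma E r s alpha ^+ k *
          enorm ((row_of f0 - row_of pi) *m invsqrtT E R r s) &
      sigma E r s alpha <=
        Num.sqrt (1 - 2 * alpha * (1 - alpha) * lambda1 E R r s)].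
Proof.
move=> f pi.
(* This is where [3 <= r] enters, together with [r < 2 * s]. *)
have s1 : (1 < s)%N by lia.
have sr : (s < r)%N by lia.
have N1 : (1 < #|{: stop V s}|)%N by apply: stop_pairs; lia.
have [_ sf0] := hf0.
split.
- move=> x; exact: stop_distr_cvg.
- move=> k; rewrite /f invsqrtTE.
  have := deviation_le s1 hrs sr hE hconn halpha0 halpha1 sf0 N1 k.
  rewrite /deviation; have -> // : row_of (stop_distr E r alpha f0 0) = row_of f0.
  by apply/rowP=> i; rewrite !mxE stop_distr0.
exact: sigma_le.
Qed.
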